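(* Let $\mathcal N=\{1,\dots,n\}$ be a universe of products with prices $p_1\ge\cdots\ge p_n\ge0$ and preference weights $v_1,\dots,v_n>0$. For any assortment $A\subseteq\mathcal N$, its expanded set is given by $$\llbracket A\rrbracket = A\cup\{i\in\mathcal N: p_i\ge \overline R(A)\}.$$ Furthermore, $\overline R(A)$ and $\llbracket A\rrbracket$ can be computed in time $O(n)$.
   Context: For an assortment $S\subseteq\mathcal N$, the MNL expected revenue is $R(S)=\frac{\sum_{i\in S}p_iv_i}{1+\sum_{i\in S}v_i}$. The expanded revenue of $A\subseteq\mathcal N$ is $\overline R(A)=\max\{R(S): A\subseteq S\subseteq\mathcal N\}$. The expanded set $\llbracket A\rrbracket$ is the assortment $S$ with $A\subseteq S\subseteq\mathcal N$ and $R(S)=\overline R(A)$ having the largest cardinality among all such assortments. For the running time, products are given sorted by non-increasing price and elementary arithmetic operations take unit time. *)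

(* Defs.v *)
From HB Require Import structures.
From mathcomp Require Import all_boot all_order all_algebra.
Set Implicit Arguments.
Unset Strict Implicit.
Unset Printing Implicit Defensive.
Import Order.TTheory GRing.Theory Num.Theory.
Local Open Scope ring_scope.

(** * Assortments under the multinomial logit (MNL) model

    The universe of products is ['I_n]: product [i] of the usual [{1, ..., n}]
    is the ordinal of value [i - 1]. *)

Section Assortments.
Variables (R : realFieldType) (n : nat).
Implicit Types (p v : 'I_n -> R) (A S T : {set 'I_n}).

Definition mnl_instance p v : Prop :=
  [/\ forall i j : 'I_n, (i <= j)%N -> p j <= p i,
      forall i, 0 <= p i
    & forall i, 0 < v i].

Definition revenue p v S : R :=
  (\sum_(i in S) p i * v i) / (1 + \sum_(i in S) v i).

(* The default value of the iterated maximum, [revenue p v A], is one of the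
   values the maximum ranges over, so this is the maximum itself. *)
Definition expanded_revenue p v A : R :=
  \big[Num.max/revenue p v A]_(S : {set 'I_n} | A \subset S) revenue p v S.

(* "[S] is the expanded set of [A]" is a relation, because uniqueness of the
   largest optimal superset is not part of the definition. *)
Definition expanded_set p v A S : Prop :=
  [/\ A \subset S, revenue p v S = expanded_revenue p v A
    & forall T, A \subset T -> revenue p v T = expanded_revenue p v A ->
        (#|T| <= #|S|)%N].

End Assortments.

(** * A unit-cost random access machine over an ordered field

    A program manipulates index (natural number) variables, field variables,
    arrays of indices and arrays of field elements; variables and arrays are
    named by natural numbers.  The syntax does not mention the field, the
    number of products or the data, so that a program is a uniform algorithm.
    Every assignment and every evaluation of a test performs at most one
    elementary operation or array access, and takes unit time.  *)

Inductive nat_op := NAdd | NSub.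
Inductive field_op := FAdd | FSub | FMul | FDiv.

Inductive instr :=
| NConst of nat & nat                (* x := c *)
| NArith of nat_op & nat & nat & nat (* x := y op z *)
| NRead of nat & nat & nat           (* x := a[i] *)
| NWrite of nat & nat & nat          (* a[i] := x *)
| FConst of nat & nat
| FArith of field_op & nat & nat & nat
| FRead of nat & nat & nat
| FWrite of nat & nat & nat.

Inductive test :=
| NLt of nat & nat
| NEq of nat & nat
| FLe of nat & nat.

Inductive prog :=
| Do of instr
| Seq of prog & prog
| If of test & prog & prog
| While of test & prog.

Definition update T (f : nat -> T) (k : nat) (c : T) : nat -> T :=
  fun j => if j == k then c else f j.

Section Semantics.
Variable R : realFieldType.

Record state := State {
  nvar : nat -> nat;
  fvar : nat -> R;
  narr : nat -> nat -> nat;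
  farr : nat -> nat -> R }.

Implicit Type s : state.

Definition eval_nat_op (o : nat_op) (x y : nat) : nat :=
  match o with NAdd => (x + y)%N | NSub => (x - y)%N end.

Definition eval_field_op (o : field_op) (x y : R) : R :=
  match o with
  | FAdd => x + y | FSub => x - y | FMul => x * y | FDiv => x / y
  end.

Definition eval_test (b : test) s : bool :=
  match b with
  | NLt x y => (nvar s x < nvar s y)%N
  | NEq x y => nvar s x == nvar s y
  | FLe x y => fvar s x <= fvar s y
  end.

Definition set_nvar s x c :=
  State (update (nvar s) x c) (fvar s) (narr s) (farr s).
Definition set_fvar s x c :=
  State (nvar s) (update (fvar s) x c) (narr s) (farr s).
Definition set_narr s a i c :=
  State (nvar s) (fvar s) (update (narr s) a (update (narr s a) i c)) (farr s).
Definition set_farr s a i c :=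
  State (nvar s) (fvar s) (narr s) (update (farr s) a (update (farr s a) i c)).

Definition eval_instr (c : instr) s : state :=
  match c with
  | NConst x k => set_nvar s x k
  | NArith o x y z => set_nvar s x (eval_nat_op o (nvar s y) (nvar s z))
  | NRead x a i => set_nvar s x (narr s a (nvar s i))
  | NWrite a i x => set_narr s a (nvar s i) (nvar s x)
  | FConst x k => set_fvar s x k%:R
  | FArith o x y z => set_fvar s x (eval_field_op o (fvar s y) (fvar s z))
  | FRead x a i => set_fvar s x (farr s a (nvar s i))
  | FWrite a i x => set_farr s a (nvar s i) (fvar s x)
  end.

(* [exec P s t s']: started in [s], [P] halts in [s'] after [t] steps. *)
Inductive exec : prog -> state -> nat -> state -> Prop :=
| ExecDo c s : exec (Do c) s 1 (eval_instr c s)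
| ExecSeq P Q s t s1 t' s2 :
    exec P s t s1 -> exec Q s1 t' s2 -> exec (Seq P Q) s (t + t')%N s2
| ExecIfT b P Q s t s' :
    eval_test b s -> exec P s t s' -> exec (If b P Q) s t.+1 s'
| ExecIfF b P Q s t s' :
    ~~ eval_test b s -> exec Q s t s' -> exec (If b P Q) s t.+1 s'
| ExecWhileF b P s : ~~ eval_test b s -> exec (While b P) s 1 s
| ExecWhileT b P s t s1 t' s2 :
    eval_test b s -> exec P s t s1 -> exec (While b P) s1 t' s2 ->
    exec (While b P) s (t + t').+1 s2.

Lemma exec_det P s t1 s1 t2 s2 :
  exec P s t1 s1 -> exec P s t2 s2 -> t1 = t2 /\ s1 = s2.
Proof.
move=> H1; elim: H1 t2 s2 => {P s t1 s1}.
- by move=> c s t2 s2 H; inversion H.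
- move=> P Q s t s1 t' s2 _ IH1 _ IH2 t2 s3 H.
  inversion H as [|? ? ? ? ? ? ? e1 e2| | | |]; subst.
  case: (IH1 _ _ e1) => -> es; subst.
  by case: (IH2 _ _ e2) => -> ->.
- move=> b P Q s t s' hb _ IH t2 s2 H.
  inversion H as [| |? ? ? ? ? ? hb' e|? ? ? ? ? ? hb' e| |]; subst.
    by case: (IH _ _ e) => -> ->.
  by case/negP: hb'.
- move=> b P Q s t s' hb _ IH t2 s2 H.
  inversion H as [| |? ? ? ? ? ? hb' e|? ? ? ? ? ? hb' e| |]; subst.
    by case/negP: hb.
  by case: (IH _ _ e) => -> ->.
- move=> b P s hb t2 s2 H.
  inversion H as [| | | | |? ? ? ? ? ? ? hb' e1 e2]; subst => //.
  by case/negP: hb.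
- move=> b P s t s1 t' s2 hb _ IH1 _ IH2 t2 s3 H.
  inversion H as [| | | |? ? ? hb'|? ? ? ? ? ? ? hb' e1 e2]; subst.
    by case/negP: hb'.
  case: (IH1 _ _ e1) => -> es; subst.
  by case: (IH2 _ _ e2) => -> ->.
Qed.

(* The input of the machine: [n] in index variable 0, the prices and the
   weights in field arrays 0 and 1, and the characteristic vector of [A] in
   index array 0.  The contents of the rest of the memory are arbitrary. *)
Definition input_state n (p v : 'I_n -> R) (A : {set 'I_n}) s : Prop :=
  [/\ nvar s 0%N = n,
      forall i : 'I_n, farr s 0%N i = p i,
      forall i : 'I_n, farr s 1%N i = v i
    & forall i : 'I_n, narr s 0%N i = (i \in A)].

(* The output: a field element [r] in field variable 0, and the characteristic
   vector of [S] in index array 1. *)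
Definition output_state n (r : R) (S : {set 'I_n}) s : Prop :=
  fvar s 0%N = r /\ (forall i : 'I_n, narr s 1%N i = (i \in S)).

End Semantics.

(* Main.v *)
Require Import Defs.
From HB Require Import structures.
From mathcomp Require Import all_boot all_order all_algebra.
From mathcomp Require Import ring zify.
Set Implicit Arguments.
Unset Strict Implicit.
Unset Printing Implicit Defensive.
Import Order.TTheory GRing.Theory Num.Theory.
Local Open Scope ring_scope.

(** The whole proof rests on linearising the revenue ratio.  For a level [r],
    put [surplus r S = \sum_(i in S) (p i - r) * v i - r]; this is
    [(revenue S - r) * (1 + \sum_(i in S) v i)], so its sign compares
    [revenue S] with [r] ([surplusE]).  The surplus is additive over products,
    so among the supersets of [A] it is maximised by adding to [A] exactly the
    products priced at least [r], and every other maximiser is contained in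
    that set [threshold_set r] ([surplus_threshold]).

    Taking for [r] the expanded revenue, the largest surplus is zero and the
    sets that reach it are the optimal assortments; hence the threshold set is
    optimal and contains all optimal sets, which makes it the only optimal set
    of largest cardinality ([expanded_setP]).  Conversely, any [T] that is the
    threshold set of its own revenue is optimal, since the surplus at level
    [revenue T] vanishes on [T] and is at most zero on every other superset of
    [A] ([self_threshold_optimal]).

    The algorithm looks for such a self-consistent [T].  It starts from
    [T = A] and scans the products by non-increasing price, adding [i] when
    [revenue T <= p i].  Adding [i] moves the revenue towards [p i] without
    exceeding it, and [p i] is at most all earlier prices, so no earlier
    decision has to be revised: after [k] products, [T] is the threshold set
    of its own revenue as far as products below [k] are concerned
    ([scanned_add], [scanned_skip]).  Each product costs a bounded number of
    machine steps, because the two sums that make up the revenue are updated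
    rather than recomputed; the costs are tracked by the total-correctness
    judgement [runs]. *)

(** * Surplus and threshold sets *)

Section Surplus.
Variables (R : realFieldType) (n : nat) (p v : 'I_n -> R).
Hypothesis v_gt0 : forall i, 0 < v i.
Implicit Types (A S T : {set 'I_n}) (r : R).

Definition surplus r S : R := \sum_(i in S) (p i - r) * v i - r.

Definition threshold_set r A : {set 'I_n} := A :|: [set i | r <= p i].

Lemma total_weight_gt0 S : 0 < 1 + \sum_(i in S) v i.
Proof. by rewrite ltr_pwDl // sumr_ge0 // => i _; exact: ltW. Qed.

Lemma surplusE r S :
  surplus r S = (revenue p v S - r) * (1 + \sum_(i in S) v i).
Proof.
have w0 := lt0r_neq0 (total_weight_gt0 S).
rewrite /surplus /revenue mulrBl divfK //.
under eq_bigr do rewrite mulrBl.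
by rewrite sumrB -mulr_sumr; ring.
Qed.

Lemma surplus_le0 r S : (surplus r S <= 0) = (revenue p v S <= r).
Proof. by rewrite surplusE pmulr_lle0 ?total_weight_gt0 // subr_le0. Qed.

Lemma surplus_eq0 r S : (surplus r S == 0) = (revenue p v S == r).
Proof.
by rewrite surplusE mulf_eq0 (gt_eqF (total_weight_gt0 S)) orbF subr_eq0.
Qed.

Lemma surplusU1 r i S : i \notin S ->
  surplus r (i |: S) = (p i - r) * v i + surplus r S.
Proof. by move=> iS; rewrite /surplus big_setU1 //= addrA. Qed.

(** Products outside [A] contribute to the surplus independently of each
    other, with the sign of [p i - r]: leaving out one of the threshold set
    gains nothing, and including one outside it is a strict loss. *)
Lemma surplus_threshold r A S : A \subset S ->
  surplus r S <= surplus r (threshold_set r A) /\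
  (surplus r S = surplus r (threshold_set r A) -> S \subset threshold_set r A).
Proof.
move=> AS; set T := threshold_set r A.
have gain_ge0 i : i \in T :\: S -> 0 <= (p i - r) * v i.
  rewrite !inE => /andP[iS /orP[/(subsetP AS)|rp]]; first by rewrite (negPf iS).
  by rewrite mulr_ge0 ?subr_ge0 // ltW.
have loss_gt0 i : i \in S :\: T -> 0 < (r - p i) * v i.
  rewrite !inE negb_or -ltNge => /andP[/andP[_ pr] _].
  by rewrite mulr_gt0 ?subr_gt0.
have -> : surplus r T = surplus r S + (\sum_(i in T :\: S) (p i - r) * v i
                                  + \sum_(i in S :\: T) (r - p i) * v i).
  have -> : \sum_(i in S :\: T) (r - p i) * v i
            = - \sum_(i in S :\: T) (p i - r) * v i.
    by rewrite -sumrN; apply: eq_bigr => i _; ring.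
  by rewrite /surplus (big_setID S) (big_setID (A := S) T) /= (setIC S T); ring.
have gains_ge0 := sumr_ge0 _ gain_ge0.
have losses_ge0 := sumr_ge0 _ (fun i iST => ltW (loss_gt0 i iST)).
split; first by rewrite lerDl addr_ge0.
rewrite -[X in X = _]addr0 => /addrI/esym/eqP.
rewrite paddr_eq0 // => /andP[_ /eqP losses0].
rewrite -setD_eq0; apply/eqP/setP => i; rewrite in_set0; apply/negP => iST.
have := psumr_eq0P (fun j jST => ltW (loss_gt0 j jST)) losses0 iST.
by move/eqP; rewrite gt_eqF ?loss_gt0.
Qed.

Lemma revenue_le_expanded A S :
  A \subset S -> revenue p v S <= expanded_revenue p v A.
Proof. by move=> AS; apply: le_bigmax_cond. Qed.

Lemma expanded_revenue_attained A :
  exists2 S : {set 'I_n}, A \subset S & revenue p v S = expanded_revenue p v A.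
Proof.
rewrite /expanded_revenue.
elim/big_ind: _ => [|x y [S AS <-] [T AT <-]|S AS].
- by exists A.
- by case: (leP (revenue p v S) (revenue p v T)) => _; [exists T | exists S].
- by exists S.
Qed.

(** An optimal set has surplus zero, so the threshold set has surplus at least
    zero, and a positive surplus would beat the maximum. *)
Lemma threshold_set_optimal A :
  revenue p v (threshold_set (expanded_revenue p v A) A)
  = expanded_revenue p v A.
Proof.
set r := expanded_revenue p v A.
have [S AS rS] := expanded_revenue_attained A.
have [le_surplus _] := surplus_threshold r AS.
have /eqP S0 : surplus r S == 0 by rewrite surplus_eq0 rS.
apply/eqP; rewrite -surplus_eq0 eq_le -{2}S0 le_surplus andbT surplus_le0.
by rewrite revenue_le_expanded // subsetUl.
Qed.

(** Optimal supersets of [A] are those of surplus zero at the level of the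
    expanded revenue, so they all lie inside the threshold set, which is one
    of them.  A largest one is therefore equal to it. *)
Lemma expanded_setP A S :
  expanded_set p v A S <-> S = threshold_set (expanded_revenue p v A) A.
Proof.
set r := expanded_revenue p v A; set T := threshold_set r A.
have AT : A \subset T by apply: subsetUl.
have rT : revenue p v T = r by apply: threshold_set_optimal.
have optimal_sub S' : A \subset S' -> revenue p v S' = r -> S' \subset T.
  move=> AS' rS'; apply: (surplus_threshold r AS').2.
  by transitivity (0 : R); [|symmetry]; apply/eqP; rewrite surplus_eq0 ?rS' ?rT.
split=> [[AS rS maxS] | ->].
  by apply/eqP; rewrite eqEcard optimal_sub //= maxS.
by split=> // S' AS' rS'; rewrite subset_leq_card ?optimal_sub.
Qed.

(** This certificate of optimality does not mention the maximum over all
    supersets, so an algorithm can establish it. *)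
Lemma self_threshold_optimal A T :
  T = threshold_set (revenue p v T) A -> revenue p v T = expanded_revenue p v A.
Proof.
move=> TE; have AT : A \subset T by rewrite TE subsetUl.
apply/eqP; rewrite eq_le revenue_le_expanded //=.
have [S AS <-] := expanded_revenue_attained A.
have [] := surplus_threshold (revenue p v T) AS; rewrite -TE => le_surplus _.
rewrite -surplus_le0 (le_trans le_surplus) //.
by rewrite le_eqVlt surplus_eq0 eqxx.
Qed.

(** * The greedy scan *)

(** The invariant of the scan.  Prices are compared with the revenue of the
    current [T], not with the revenue at the time of the decision, so that for
    [k = n] it becomes the fixed-point equation of [self_threshold_optimal]. *)
Definition scanned A k T : Prop :=
  T = A :|: [set i : 'I_n | (i < k)%N && (revenue p v T <= p i)].

Lemma scanned0 A : scanned A 0 A.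
Proof. by apply/setP => i; rewrite !inE orbF. Qed.

Lemma scanned_all A T : scanned A n T -> T = threshold_set (revenue p v T) A.
Proof. by move=> TE; rewrite {1}TE; apply/setP => i; rewrite !inE ltn_ord. Qed.

Lemma scanned_notin A (i : 'I_n) T : scanned A i T -> i \notin A -> i \notin T.
Proof. by move=> -> iA; rewrite !inE ltnn (negPf iA). Qed.

Lemma scanned_skip A (i : 'I_n) T :
  scanned A i T -> (i \in A) || (p i < revenue p v T) -> scanned A i.+1 T.
Proof.
move=> TE skip_i; rewrite /scanned {1}TE; apply/setP => j; rewrite !inE.
case: (eqVneq j i) => [->|ji]; last first.
  by rewrite ltnS [in RHS]leq_eqVlt val_eqE (negPf ji).
by rewrite ltnn ltnSn /= orbF leNgt; case/orP: skip_i => ->; rewrite ?orbF.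
Qed.

(** At level [p i] the product [i] adds nothing to the surplus, so the revenue
    stays below [p i]. *)
Lemma revenueU1_le (i : 'I_n) T : i \notin T ->
  revenue p v T <= p i -> revenue p v (i |: T) <= p i.
Proof.
by move=> iT; rewrite -!surplus_le0 surplusU1 // subrr mul0r add0r.
Qed.

(** The revenue changes, but every product up to [i] has price at least [p i],
    which bounds both the old and the new revenue.  So all of them pass the
    price test before and after the addition. *)
Lemma scanned_add A (i : 'I_n) T :
  (forall j k : 'I_n, (j <= k)%N -> p k <= p j) ->
  scanned A i T -> i \notin A -> revenue p v T <= p i ->
  scanned A i.+1 (i |: T).
Proof.
move=> p_noninc TE iA rTi; have iT := scanned_notin TE iA.
have rTi' := revenueU1_le iT rTi.
rewrite /scanned {1}TE; apply/setP => j; rewrite !inE orbCA ltnS.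
congr (_ || _); case: (leqP j i) => [ji|ij] /=.
  have pij := p_noninc _ _ ji.
  rewrite (le_trans rTi pij) (le_trans rTi' pij) andbT.
  by rewrite leq_eqVlt in ji.
by rewrite ltnNge (ltnW ij) /= -val_eqE gtn_eqF.
Qed.

End Surplus.

(** * Total correctness with cost *)

Section Runs.
Variable R : realFieldType.
Implicit Types (P : prog) (s : state R) (Q : state R -> Prop).

Definition runs P s c Q : Prop :=
  exists t s', [/\ exec P s t s', (t <= c)%N & Q s'].

Lemma runs_seq P1 P2 s c1 c2 Q1 Q2 :
  runs P1 s c1 Q1 -> (forall s', Q1 s' -> runs P2 s' c2 Q2) ->
  runs (Seq P1 P2) s (c1 + c2) Q2.
Proof.
move=> [t1 [s1 [e1 le1 /[swap] /[apply]]]] [t2 [s2 [e2 le2 Qs2]]].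
by exists (t1 + t2)%N, s2; split; [exact: ExecSeq e1 e2 | exact: leq_add |].
Qed.

Lemma runs_if b P1 P2 s c Q :
  (eval_test b s -> runs P1 s c Q) -> (~~ eval_test b s -> runs P2 s c Q) ->
  runs (If b P1 P2) s c.+1 Q.
Proof.
move=> H1 H2; have [bs|bs] := boolP (eval_test b s).
  have [t [s' [e le_t Qs']]] := H1 bs.
  by exists t.+1, s'; split=> //; exact: ExecIfT.
have [t [s' [e le_t Qs']]] := H2 bs.
by exists t.+1, s'; split=> //; exact: ExecIfF.
Qed.

Lemma runs_weaken P s c c' Q : (c <= c')%N -> runs P s c Q -> runs P s c' Q.
Proof. by move=> cc' [t [s' [e le_t]]]; exists t, s'; rewrite (leq_trans le_t). Qed.

Fixpoint block (c : instr) (cs : seq instr) : prog :=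
  if cs is c' :: cs' then Seq (Do c) (block c' cs') else Do c.

Lemma runs_block c cs s Q :
  Q (foldl (fun s' c' => eval_instr c' s') s (c :: cs)) ->
  runs (block c cs) s (size cs).+1 Q.
Proof.
elim: cs c s => [|c' cs IH] c s /= Qs.
  by exists 1%N, (eval_instr c s); split=> //; exact: ExecDo.
apply: (@runs_seq _ _ _ 1 _ (eq (eval_instr c s))) => [|_ <-]; last exact: IH.
by exists 1%N, (eval_instr c s); split=> //; exact: ExecDo.
Qed.

(** Index variable 1 is the loop counter; index variables 0 and 2 hold the
    bound and the constant one. *)
Definition for_each (body : prog) : prog :=
  Seq (Do (NConst 1 0))
      (While (NLt 1 0) (Seq body (Do (NArith NAdd 1 1 2)))).

(** Besides its body, each iteration pays for one test and one increment; the
    two further steps are the reset of the counter and the final test. *)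
Lemma runs_for_each n body c (Inv : nat -> state R -> Prop) s :
  (forall k s, Inv k s -> nvar s 0%N = n /\ nvar s 2%N = 1%N) ->
  (forall k s x, Inv k s -> Inv k (set_nvar s 1 x)) ->
  (forall (i : 'I_n) s, Inv i s -> nvar s 1%N = i ->
     runs body s c (fun s' => Inv i.+1 s' /\ nvar s' 1%N = i)) ->
  Inv 0%N s -> runs (for_each body) s (c.+2 * n).+2 (Inv n).
Proof.
move=> Inv_const Inv_counter Inv_body Inv0.
(* The induction is on the number [d] of iterations still to be done. *)
have iterations d : (d <= n)%N -> forall s1, Inv (n - d)%N s1 ->
    nvar s1 1%N = (n - d)%N ->
    runs (While (NLt 1 0) (Seq body (Do (NArith NAdd 1 1 2)))) s1
         (c.+2 * d).+1 (Inv n).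
  elim: d => [|d IH] dn s1 Inv1 counter1; have [bound _] := Inv_const _ _ Inv1.
    rewrite subn0 in Inv1 counter1; exists 1%N, s1; split=> //.
    by apply: ExecWhileF; rewrite /= counter1 bound ltnn.
  have lt_n : (n - d.+1 < n)%N by lia.
  have [t1 [s2 [e1 le1 [Inv2 counter2]]]] :=
    Inv_body (Ordinal lt_n) s1 Inv1 counter1.
  have [_ one] := Inv_const _ _ Inv2.
  have next : (n - d.+1).+1 = (n - d)%N by lia.
  have [||t2 [s3 [e2 le2 Inv3]]] :=
      IH (ltnW dn) (set_nvar s2 1 (n - d.+1).+1).
  - by rewrite -next; apply: Inv_counter.
  - by rewrite /= /update eqxx.
  exists (t1 + 1 + t2).+1, s3; split=> //; last by lia.
  apply: (@ExecWhileT _ _ _ _ _ (set_nvar s2 1 (n - d.+1).+1)) e2.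
    by rewrite /= counter1 bound.
  apply: ExecSeq e1 _.
  have -> : (n - d.+1).+1 = (nvar s2 1 + nvar s2 2)%N.
    by rewrite counter2 one addn1.
  exact: ExecDo.
apply: (@runs_seq _ _ _ 1 _ (eq (set_nvar s 1 0))) => [|_ <-].
  by exists 1%N, (set_nvar s 1 0); split=> //; exact: ExecDo.
by apply: iterations; rewrite // subnn //; apply: Inv_counter.
Qed.

End Runs.

(** * The program *)

(** Field variables 1 and 2 hold the numerator and the denominator of the
    revenue, field variable 0 their quotient. *)
Definition add_product : prog :=
  block (FRead 3 0 1)
    [:: FRead 4 1 1; FArith FMul 5 3 4; FArith FAdd 1 1 5; FArith FAdd 2 2 4;
        FArith FDiv 0 1 2; NWrite 1 1 2].

Definition skip : prog := Do (NConst 3 0).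

(** The output cell is cleared first: memory outside the input is arbitrary. *)
Definition load_product : prog :=
  Seq (block (NConst 3 0) [:: NWrite 1 1 3; NRead 3 0 1])
      (If (NEq 3 2) add_product skip).

Definition scan_product : prog :=
  Seq (block (NRead 3 0 1) [:: FRead 3 0 1])
      (If (NEq 3 2) skip (If (FLe 0 3) add_product skip)).

(** Loading [A] takes a separate pass, because the first price comparison
    already needs the revenue of the whole of [A]. *)
Definition expand : prog :=
  Seq (block (NConst 2 1) [:: FConst 0 0; FConst 1 0; FConst 2 1])
      (Seq (for_each load_product) (for_each scan_product)).

Section Correctness.
Variables (R : realFieldType) (n : nat) (p v : 'I_n -> R).
Hypothesis inst : mnl_instance p v.
Implicit Types (A T : {set 'I_n}) (s : state R).

(** The parameter [m] delimits the part of the output array that has been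
    initialised. *)
Record represents A T m s : Prop := Represents {
  rep_input : input_state p v A s;
  rep_one : nvar s 2%N = 1%N;
  rep_num : fvar s 1%N = \sum_(i in T) p i * v i;
  rep_den : fvar s 2%N = 1 + \sum_(i in T) v i;
  rep_revenue : fvar s 0%N = revenue p v T;
  rep_set : forall i : 'I_n, (i < m)%N -> narr s 1%N i = (i \in T) }.

Lemma represents_const A T m s :
  represents A T m s -> nvar s 0%N = n /\ nvar s 2%N = 1%N.
Proof. by case=> [[]]. Qed.

Lemma represents_counter A T m s x :
  represents A T m s -> represents A T m (set_nvar s 1 x).
Proof. by case=> [[]]. Qed.

Lemma runs_skip A T m s (i : 'I_n) :
  represents A T m s -> nvar s 1%N = i ->
  runs skip s 1 (fun s' => represents A T m s' /\ nvar s' 1%N = i).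
Proof. by move=> [[]] *; apply: (runs_block (cs := [::])). Qed.

Lemma runs_add_product A T m s (i : 'I_n) :
  represents A T m s -> nvar s 1%N = i -> (i < m)%N -> i \notin T ->
  runs add_product s 7
    (fun s' => represents A (i |: T) m s' /\ nvar s' 1%N = i).
Proof.
move=> [[n0 f0 f1 a0] one num den rev out] counter im iT.
apply: runs_block; split; last by [].
rewrite /= /set_nvar /set_fvar /set_narr /update /= counter f0 f1 one num den.
have numE : \sum_(j in T) p j * v j + p i * v i = \sum_(j in i |: T) p j * v j.
  by rewrite big_setU1 //= addrC.
have denE : 1 + \sum_(j in T) v j + v i = 1 + \sum_(j in i |: T) v j.
  by rewrite big_setU1 //=; ring.
rewrite numE denE; split=> //= j jm; rewrite val_eqE !inE.
by case: eqVneq => // _; rewrite out.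
Qed.

Lemma runs_load_product A (i : 'I_n) s :
  represents A (A :&: [set j : 'I_n | (j < i)%N]) i s -> nvar s 1%N = i ->
  runs load_product s 11
    (fun s' => represents A (A :&: [set j : 'I_n | (j < i.+1)%N]) i.+1 s'
               /\ nvar s' 1%N = i).
Proof.
set T := A :&: _ => -[[n0 f0 f1 a0] one num den rev out] counter.
have iT : i \notin T by rewrite !inE ltnn andbF.
pose Q s' := [/\ represents A T i.+1 s', nvar s' 1%N = i
               & nvar s' 3%N = (i \in A)].
apply: (@runs_seq _ _ _ _ 3 8 Q).
  apply: (@runs_block _ _ [:: _; _]).
  rewrite /= /set_nvar /set_narr /update /= counter a0.
  split=> //; split=> //= j; rewrite ltnS leq_eqVlt !val_eqE.
  by case: eqVneq => [->|_ /out]; rewrite ?(negPf iT).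
move=> s' [rep' counter' inA]; apply: runs_if => /=;
  rewrite (rep_one rep') inA eqb1 => iA.
  have -> : A :&: [set j : 'I_n | (j < i.+1)%N] = i |: T.
    apply/setP => j; rewrite !inE ltnS leq_eqVlt val_eqE.
    by case: eqVneq => [->|]; rewrite ?iA.
  exact: runs_add_product.
have -> : A :&: [set j : 'I_n | (j < i.+1)%N] = T.
  apply/setP => j; rewrite !inE ltnS leq_eqVlt val_eqE.
  by case: eqVneq => [->|]; rewrite ?(negPf iA).
by apply: runs_weaken (runs_skip rep' counter').
Qed.

Definition scan_state A k s : Prop :=
  exists2 T, scanned p v A k T & represents A T n s.

Lemma runs_scan_product A (i : 'I_n) s :
  scan_state A i s -> nvar s 1%N = i ->
  runs scan_product s 11
    (fun s' => scan_state A i.+1 s' /\ nvar s' 1%N = i).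
Proof.
case: inst => p_noninc _ v_gt0 [T scT rep] counter.
pose Q s' := [/\ represents A T n s', nvar s' 1%N = i,
                 nvar s' 3%N = (i \in A) & fvar s' 3%N = p i].
have done_with T' s' P c : scanned p v A i.+1 T' ->
    runs P s' c (fun s1 => represents A T' n s1 /\ nvar s1 1%N = i) ->
    runs P s' c (fun s1 => scan_state A i.+1 s1 /\ nvar s1 1%N = i).
  move=> scT' [t [s1 [e le_t [rep1 counter1]]]].
  by exists t, s1; split=> //; split=> //; exists T'.
apply: (@runs_seq _ _ _ _ 2 9 Q).
  case: rep => [[n0 f0 f1 a0] one num den rev out].
  apply: (@runs_block _ _ [:: _]).
  by rewrite /= /set_nvar /set_fvar /update /= counter a0 f0.
move=> s' [rep' counter' inA price].
have skip_runs c : (0 < c)%N -> (i \in A) || (p i < revenue p v T) ->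
    runs skip s' c (fun s1 => scan_state A i.+1 s1 /\ nvar s1 1%N = i).
  move=> c0 skip_i; apply: (done_with T); first exact: scanned_skip.
  exact: runs_weaken (runs_skip rep' counter').
apply: runs_if => /=; rewrite (rep_one rep') inA eqb1 => iA.
  by apply: skip_runs; rewrite // iA.
apply: runs_if => /=; rewrite (rep_revenue rep') price => rTi.
  apply: (done_with (i |: T)); first exact: scanned_add.
  by apply: runs_add_product => //; exact: scanned_notin scT iA.
by apply: skip_runs; rewrite // ltNge rTi orbT.
Qed.

Lemma runs_expand A s : input_state p v A s ->
  runs expand s (26 * n.+1) (scan_state A n).
Proof.
move=> [n0 f0 f1 a0].
(* Four initial steps, then two loops of at most 11 steps per body. *)
apply: (@runs_weaken _ _ _ (4 + ((13 * n).+2 + (13 * n).+2))); first by lia.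
pose loaded k s' := represents A (A :&: [set j : 'I_n | (j < k)%N]) k s'.
apply: (@runs_seq _ _ _ _ _ _ (loaded 0%N)).
  apply: (@runs_block _ _ [:: _; _; _]); rewrite /loaded.
  have -> : A :&: [set j : 'I_n | (j < 0)%N] = set0.
    by apply/setP => j; rewrite !inE andbF.
  split=> //=; rewrite /update /= ?/revenue ?big_set0 ?mul0r ?addr0 //.
move=> s1 rep1; apply: (runs_seq (Q1 := loaded n)) => [|s2 rep2].
  apply: runs_for_each rep1 => [k s2|k s2 x|i s2].
  - exact: represents_const.
  - exact: represents_counter.
  - exact: runs_load_product.
apply: runs_for_each => [k s3 [T _]|k s3 x [T scT rep3]|i s3|].
- exact: represents_const.
- by exists T => //; exact: represents_counter.
- exact: runs_scan_product.
- exists A; first exact: scanned0.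
  move: rep2; rewrite /loaded.
  suff -> : A :&: [set j : 'I_n | (j < n)%N] = A by [].
  by apply/setP => j; rewrite !inE ltn_ord andbT.
Qed.

End Correctness.

(** * The expanded set and its linear-time computation *)

Theorem lemma3p3 (R : realFieldType) :
  (forall (n : nat) (p v : 'I_n -> R), mnl_instance p v ->
    forall A S : {set 'I_n},
      expanded_set p v A S <->
      S = A :|: [set i | expanded_revenue p v A <= p i]) /\
  (exists (P : prog) (C : nat),
    forall (n : nat) (p v : 'I_n -> R), mnl_instance p v ->
    forall (A : {set 'I_n}) (s : state R), input_state p v A s ->
    exists (t : nat) (s' : state R) (S : {set 'I_n}),
      [/\ exec P s t s', (t <= C * n.+1)%N, expanded_set p v A S
        & output_state (expanded_revenue p v A) S s']).
Proof.
split=> [n p v [_ _ v_gt0] A S|]; first exact: expanded_setP.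
exists expand, 26 => n p v inst A s in_s.
have [t [s' [e le_t [T scT rep]]]] := runs_expand inst in_s.
have [_ _ v_gt0] := inst.
have TE := scanned_all scT; have optT := self_threshold_optimal v_gt0 TE.
exists t, s', T; split=> //; first by apply/expanded_setP; rewrite // -optT.
split=> [|i]; first by rewrite (rep_revenue rep).
exact: (rep_set rep).
Qed.
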